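(* Let $p > 2$ be a prime number. Then: (i) if $p = 3$ or $p \equiv 1 \pmod 4$, then $\kappa(16p) \equiv 2 \pmod 4$; (ii) if $p \equiv 3 \pmod 4$ and $p \neq 3$, then $\kappa(16p) \equiv 0 \pmod 4$.
   Context: A real quadratic number is a real irrational root $w$ of a quadratic polynomial with integer coefficients; $w'$ denotes its algebraic conjugate over $\mathbb{Q}$. The discriminant $\mathrm{disc}(w)$ of $w$ is $b^2-4ac$, where $aw^2+bw+c=0$ with $a,b,c\in\mathbb{Z}$, $a>0$, $\gcd(a,b,c)=1$. A real quadratic number $w$ is reduced if $w>1$ and $-1<w'<0$. For a positive non-square integer $D$, $\kappa(D)$ denotes the (finite) number of reduced real quadratic numbers $w$ with $\mathrm{disc}(w)=D$. *)

(* Defs.v *)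
From HB Require Import structures.
From mathcomp Require Import all_boot all_order all_algebra.
From mathcomp Require Import finmap.
From mathcomp Require Import boolp classical_sets functions cardinality reals.
From mathcomp Require Import ring lra zify.

Set Implicit Arguments.
Unset Strict Implicit.
Unset Printing Implicit Defensive.

Import Order.TTheory GRing.Theory Num.Theory.

Local Open Scope classical_set_scope.
Local Open Scope ring_scope.

Section QuadraticNumbers.
Variable R : realType.
Implicit Types w v : R.

Definition quadratic_root (a b c : int) w : Prop :=
  a%:~R * w ^+ 2 + b%:~R * w + c%:~R = 0.

Definition real_quadratic w : Prop :=
  irrational w /\
  exists a b c : int, a != 0 /\ quadratic_root a b c w.

(* [v] is a conjugate of [w] over Q other than [w] itself, i.e. both have the
   same annihilating polynomials over Q; for a real quadratic [w] there is
   exactly one such [v], the other root of its minimal polynomial. *)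
Definition conjugate w v : Prop :=
  v <> w /\
  forall q : {poly rat}, root (map_poly ratr q) w = root (map_poly ratr q) v.

(* [D] is the discriminant of [w]. The triple (a, b, c), hence [D], is
   determined by a real quadratic [w]. *)
Definition has_disc w (D : int) : Prop :=
  exists a b c : int,
    [/\ 0 < a, gcdz (gcdz a b) c = 1, quadratic_root a b c w
      & D = b ^+ 2 - 4 * a * c].

Definition reduced w : Prop :=
  [/\ real_quadratic w, 1 < w & exists2 v, conjugate w v & -1 < v < 0].

Definition reduced_of_disc (D : nat) : set R :=
  [set w | reduced w /\ has_disc w D%:Z].

(* [fset_set] is junk on infinite sets; [finite_reduced_of_disc] below shows
   that this case does not occur. *)
Definition kappa (D : nat) : nat := #|` fset_set (reduced_of_disc D)|.

Lemma quadratic_root_conjugate (a b c : int) w v :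
  conjugate w v -> quadratic_root a b c w -> quadratic_root a b c v.
Proof.
move=> [_ wv]; rewrite /quadratic_root => h.
pose q : {poly rat} := a%:~R *: 'X^2 + b%:~R *: 'X + (c%:~R)%:P.
have qE x : (map_poly ratr q).[x] = a%:~R * x ^+ 2 + b%:~R * x + c%:~R :> R.
  by rewrite /q !rmorphD /= !map_polyZ /= map_polyXn map_polyX map_polyC /=
    !ratr_int !hornerE.
by have := wv q; rewrite !rootE !qE h eqxx => /esym/eqP.
Qed.

Lemma finite_reduced_of_disc (D : nat) : finite_set (reduced_of_disc D).
Proof.
pose s := Num.sqrt (D%:R : R).
pose f (t : (nat * nat) * (nat * nat)) : R :=
  ((-1) ^+ t.2.1 * t.1.2%:R + (-1) ^+ t.2.2 * s) / (2 * t.1.1%:R).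
have fin : finite_set ((`I_D.+1 `*` `I_D.+1) `*` (`I_2 `*` `I_2)).
  by do !apply: finite_setX; exact: finite_II.
apply: sub_finite_set (finite_image f fin) => w [[[wirr _] w1 [v wv v01]]].
move=> [a [b [c [a0 _ hw DE]]]].
have hv := quadratic_root_conjugate wv hw.
have vw : v - w != 0 by rewrite subr_eq0; apply/eqP; case: wv.
have aR : 0 < (a%:~R : R) by rewrite ltr0z.
have bE : (b%:~R : R) = - a%:~R * (v + w).
  move: hw hv; rewrite /quadratic_root => hw hv.
  apply: (mulIf vw); apply/eqP; rewrite -subr_eq0; apply/eqP; lra.
have cE : (c%:~R : R) = a%:~R * (v * w).
  by move: hw; rewrite /quadratic_root bE => hw; lra.
have c0 : c < 0.
  rewrite -(ltrz0 R) cE pmulr_rlt0//.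
  by case/andP: v01 => _ v0; rewrite nmulr_rlt0//; lra.
have [aD bD] : (`|a| <= D)%N /\ (`|b| <= D)%N by split; nia.
have DR : (D%:R : R) = (2 * a%:~R * w + b%:~R) ^+ 2.
  rewrite -[D%:R]/((D%:Z)%:~R) DE !(rmorphB, rmorphM, rmorphXn)/= bE cE; ring.
have sE : s = `|2 * a%:~R * w + b%:~R| by rewrite /s DR sqrtr_sqr.
have aE : (`|a|%N%:R : R) = a%:~R.
  by rewrite natr_absz gtr0_norm.
have bsE : (`|b|%N%:R : R) = `|b%:~R| by rewrite natr_absz intr_norm.
exists ((`|a|%N, `|b|%N), (nat_of_bool (0 < (b%:~R : R)),
   nat_of_bool ((2 * a%:~R * w + b%:~R : R) < 0))).
  by split; split => //=; case: ltrP.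
rewrite /f /= aE bsE sE; apply: (canLR (mulfK _)); first by lra.
set y := 2 * a%:~R * w + b%:~R.
have -> : (-1) ^+ (y < 0)%R * `|y| = y by rewrite -realEsign ?num_real.
have -> : (-1) ^+ (0 < (b%:~R : R))%R * `|b%:~R : R| = - b%:~R.
  by case: (ltrP 0 (b%:~R : R)) => h;
    rewrite ?(gtr0_norm h) ?(ler0_norm h) ?expr1 ?expr0 ?mulN1r ?mul1r.
by rewrite /y; ring.
Qed.

End QuadraticNumbers.

(* Main.v *)
(** Reduced numbers of discriminant 16p correspond to positive triples (a, b, c)
    with b^2 + a c = 4p, |a - c| < 2b and a, c not both even, through
    w = (b + sqrt(4p)) / a. The odd values of the form a x^2 + 2b x y - c y^2
    are all congruent modulo 4, and exchanging a and c negates this class;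
    hence kappa(16p) = 2K, where K counts the triples of class 1.

    Replacing b by a n - b, where n is the integer part of w, keeps a and is an
    involution of the triples of class 1, so K is congruent modulo 2 to the
    number of its fixed points. At a fixed point a divides 2b and b^2 + a c = 4p,
    which leaves only a = 1, and a = 4 when p = 3 mod 4 and p <> 3. *)

Require Import Defs.
From mathcomp Require Import all_boot all_order all_algebra finmap.
From mathcomp Require Import boolp classical_sets functions cardinality reals.
From mathcomp Require Import ring lra zify.

Set Implicit Arguments.
Unset Strict Implicit.
Unset Printing Implicit Defensive.

Import Order.TTheory GRing.Theory Num.Theory.

Local Open Scope fset_scope.
Local Open Scope nat_scope.

(** * Parity under an involution, and integer square roots *)

(** Removing a moved point together with its image changes neither the parity nor the fixed points;
    once no moved point is left, every point is fixed. *)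
Lemma odd_card_involution (T : choiceType) (f : T -> T) (A : {fset T}) :
  {in A, forall x, f x \in A} -> {in A, cancel f f} ->
  odd #|` A| = odd #|` [fset x in A | f x == x]|.
Proof.
have [n] := ubnP #|` A|; elim: n A => // n IH A; rewrite ltnS => ltA fA fK.
have [/existsP[[x xA] /= fx]|/existsPn fix_all] :=
  boolP [exists x : A, f (val x) != val x].
  have fxA := fA _ xA.
  have cardA : #|` A| = (#|` A `\ x `\ f x|).+2.
    by rewrite (cardfsD1 x) xA (cardfsD1 (f x) (A `\ x)) !inE fx fxA.
  rewrite cardA /= negbK IH.
  - congr (odd #|` _|); apply/fsetP => y; rewrite !inE /=.
    case yA: (y \in A); rewrite ?andbF//= andbT.
    have [-> /=|_] := eqVneq y (f x); first by rewrite fK// eq_sym (negbTE fx).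
    by have [->|//] := eqVneq y x; rewrite (negbTE fx).
  - by move: ltA; rewrite cardA; apply: ltn_trans.
  - move=> y; rewrite !inE => /and3P[y1 y2 yA]; rewrite fA// andbT.
    apply/andP; split.
      by apply: contraNneq y2 => e; rewrite -(fK _ yA) e fK.
    by apply: contraNneq y1 => e; rewrite -(fK _ yA) e.
  by move=> y; rewrite !inE => /and3P[_ _ yA]; exact: fK.
congr (odd #|` _|); apply/fsetP => y; rewrite !inE /=.
case yA: (y \in A) => //=.
by have := fix_all [` yA]; rewrite negbK => ->.
Qed.

Lemma sqrt_bounds n : exists s, s ^ 2 <= n < s.+1 ^ 2.
Proof.
elim: n => [|n [s /andP[s1 s2]]]; first by exists 0.
have [h|h] := ltnP n.+1 (s.+1 ^ 2); first by exists s; rewrite h; lia.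
by exists s.+1; rewrite h; nia.
Qed.

(** * Reduced triples and their two genera *)

(* (a, b, c) stands for the form a x^2 + 2b x y - c y^2; the inequalities say
   that it is negative at (1, 1) and positive at (1, -1). *)
Definition reduced_triple (m : nat) (t : nat * nat * nat) : bool :=
  let: (a, b, c) := t in
  [&& 0 < a, 0 < c, b ^ 2 + a * c == 4 * m, a < c + 2 * b, c < a + 2 * b
    & odd a || odd c].

(** As a and c are positive, b^2 + a c = 4m bounds every entry by 4m, so the box loses no triple. *)
Definition reduced_triples (m : nat) : {fset nat * nat * nat} :=
  let I := [fset i in iota 0 (4 * m).+1] in
  [fset t in (I `*` I) `*` I | reduced_triple m t].

Lemma in_reduced_triples m t :
  (t \in reduced_triples m) = reduced_triple m t.
Proof.
case: t => [[a b] c]; rewrite !inE /= andb_idl//.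
move=> /and5P[a0 c0 /eqP e _ _]; rewrite !mem_iota.
by apply/andP; split; [apply/andP; split|]; nia.
Qed.

(* The odd values of the form are 1 modulo 4: both a and -c are values. *)
Definition plus_genus (t : nat * nat * nat) : bool :=
  let: (a, _, c) := t in if odd a then a %% 4 == 1 else c %% 4 == 3.

Definition swap_triple (t : nat * nat * nat) := let: (a, b, c) := t in (c, b, a).

(** If only one of a and c is odd, both sides read its class, with opposite signs. If both are odd,
    so is b; then a c = -b^2 = 3 modulo 4, so exactly one of a and c is 1 modulo 4. *)
Lemma plus_genus_swap m t :
  reduced_triple m t -> plus_genus (swap_triple t) = ~~ plus_genus t.
Proof.
case: t => [[a b] c] /and5P[a0 c0 /eqP e _ /andP[_ oac]] /=.
case oa: (odd a); case oc: (odd c); rewrite ?oa ?oc in oac => //; last first.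
- lia.
- lia.
have ob : odd b.
  have := congr1 odd e.
  by rewrite !(oddD, oddM, oddX)/= oa oc; case: (odd b).
have : (b ^ 2) %% 4 = 1.
  by rewrite (_ : b = b %/ 2 * 2 + 1) ?sqrnD ?expnMn; lia.
have : (a * c) %% 4 = ((a %% 4) * (c %% 4)) %% 4 by rewrite modnMml modnMmr.
have : a %% 4 = 1 \/ a %% 4 = 3 by lia.
have : c %% 4 = 1 \/ c %% 4 = 3 by lia.
move: e; set x := b ^ 2; set y := a * c.
by move=> e [] -> [] ->; lia.
Qed.

Lemma card_reduced_triples m :
  #|` reduced_triples m| = (#|` [fset t in reduced_triples m | plus_genus t]|).*2.
Proof.
have := in_reduced_triples m; move: (reduced_triples m) => A inA.
have swap_red t : reduced_triple m (swap_triple t) = reduced_triple m t.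
  case: t => [[a b] c]; rewrite /= [c * a]mulnC.
  by rewrite orbC; apply/idP/idP => /and5P[-> -> -> -> /andP[-> ->]].
set P := [fset t in A | plus_genus t].
have inP t : (t \in P) = reduced_triple m t && plus_genus t.
  by rewrite !inE /= inA.
rewrite -(cardfsID P) (_ : A `&` P = P); last first.
  by apply/fsetP => t; rewrite in_fsetI inP inA andbA andbb.
have -> : A `\` P = [fset swap_triple t | t in P].
  apply/fsetP => t; rewrite in_fsetD inP inA; apply/idP/imfsetP => /=.
    move=> /andP[nt rt]; exists (swap_triple t); last by case: t {nt rt} => [[]].
    by move: nt; rewrite inP swap_red (plus_genus_swap rt) rt.
  move=> [u]; rewrite inP => /andP[ru pu] ->.
  by rewrite swap_red (plus_genus_swap ru) pu ru.
have swap_inj : injective swap_triple.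
  by move=> [[a b] c] [[a' b'] c'] [-> -> ->].
have -> : #|` [fset swap_triple t | t in P]| = #|` P|.
  exact: card_imfset swap_inj.
by rewrite addnn.
Qed.

(** * The reflection of triples that keeps a *)

(* With s the integer part of sqrt(4m), the last conditions on b say that
   max(s - a + 1, a - s) <= b <= s. *)
Lemma reduced_tripleE m s a b c : s ^ 2 < 4 * m < s.+1 ^ 2 ->
  reduced_triple m (a, b, c) =
  [&& 0 < a, b ^ 2 + a * c == 4 * m, b <= s, s < a + b, a <= b + s
    & odd a || odd c].
Proof.
move=> /andP[s1 s2]; rewrite /reduced_triple.
have [->//|a0] := posnP a.
have [e|] := eqVneq (b ^ 2 + a * c) (4 * m); rewrite ?andbF//=.
have -> : (0 < c) = (b <= s).
  by apply/idP/idP => h; nia.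
have [bs|//] := leqP b s.
have c0 : 0 < c by nia.
(* Multiplied by a, this inequality reads (a - b)^2 < 4m, and the next one 4m < (a + b)^2. *)
have -> : (a < c + 2 * b) = (a <= b + s).
  by apply/idP/idP => h; nia.
have -> : (c < a + 2 * b) = (s < a + b).
  by apply/idP/idP => h; nia.
by rewrite /= !andbA; congr (_ && _); rewrite andbC.
Qed.

(* (b + s) %/ a is the integer part of the root (b + sqrt(4m)) / a. *)
Definition reflect_triple m s (t : nat * nat * nat) :=
  let: (a, b, c) := t in
  let b' := a * ((b + s) %/ a) - b in (a, b', (4 * m - b' ^ 2) %/ a).

(** On roots the map is w -> n - w', with n the integer part of w; since -1 < w' < 0, the integer
    part is again n, whence an involution. On forms it is the substitution of (x + n y, -y) for (x,
    y), which explains the formula for c'. *)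
Lemma reflect_tripleP m s a b c : s ^ 2 < 4 * m < s.+1 ^ 2 ->
  reduced_triple m (a, b, c) -> exists b' c', [/\
    reflect_triple m s (a, b, c) = (a, b', c'),
    reduced_triple m (a, b', c'),
    b + b' = a * ((b + s) %/ a),
    (b' + s) %/ a = (b + s) %/ a &
    c' + a * ((b + s) %/ a) ^ 2 = c + 2 * b * ((b + s) %/ a)].
Proof.
move=> sP; have /andP[s1 s2] := sP.
rewrite (reduced_tripleE _ _ _ sP) => /and5P[a0 /eqP e bs sab /andP[abs oac]].
rewrite /reflect_triple; set n := (b + s) %/ a; set r := (b + s) %% a.
have nr : b + s = n * a + r by exact: divn_eq.
have ra : r < a by rewrite ltn_mod.
have n0 : 0 < n by rewrite divn_gt0.
have ar : a + r <= b + s by rewrite nr leq_add2r leq_pmull.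
have rs : r <= s by lia.
(* This is a n - b, in a form that shows b' <= s and, as r < a, also s < a + b'. *)
pose b' := s - r.
have bb' : b + b' = a * n by rewrite /b'; lia.
have -> : a * n - b = b' by lia.
have b'2 : b' ^ 2 + 2 * (a * n) * b = (a * n) ^ 2 + b ^ 2.
  by rewrite -bb'; lia.
have b's : b' ^ 2 < 4 * m.
  by apply: leq_ltn_trans s1; rewrite leq_exp2r // leq_subr.
(* Multiplied by a, this follows from (a n - b)^2 = b'^2 < 4m; it keeps the subtraction in c' from
   being truncated. *)
have c'0 : a * n ^ 2 <= c + 2 * b * n.
  by rewrite -(leq_pmul2l a0); lia.
pose c' := c + 2 * b * n - a * n ^ 2.
have e' : b' ^ 2 + a * c' = 4 * m.
  have : a * c' + a * (a * n ^ 2) = a * (c + 2 * b * n).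
    by rewrite -mulnDr subnK.
  lia.
have -> : (4 * m - b' ^ 2) %/ a = c' by rewrite -e' addKn mulKn.
have cc' : c' + a * n ^ 2 = c + 2 * b * n by rewrite subnK.
exists b', c'; split=> //.
  rewrite (reduced_tripleE _ _ _ sP) a0 e' eqxx leq_subr /=.
  apply/and3P; split; [clear -ra rs; lia|clear -ar bs rs; lia|].
  case oa: (odd a) oac => //= oc.
  have := congr1 odd cc'.
  by rewrite !(oddD, oddM, oddX) oa oc; case: (odd c').
have -> : b' + s = n * a + (s - b) by lia.
by rewrite divnMDl// divn_small ?addn0//; lia.
Qed.

Lemma reflect_triple_reduced m s t : s ^ 2 < 4 * m < s.+1 ^ 2 ->
  reduced_triple m t -> reduced_triple m (reflect_triple m s t).
Proof.
move: t => [[a b] c] sP rt.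
by have [b' [c' [-> //]]] := reflect_tripleP sP rt.
Qed.

Lemma reflect_tripleK m s t : s ^ 2 < 4 * m < s.+1 ^ 2 ->
  reduced_triple m t -> reflect_triple m s (reflect_triple m s t) = t.
Proof.
move: t => [[a b] c] sP rt.
have [b' [c' [-> _ bb' be _]]] := reflect_tripleP sP rt.
rewrite /reflect_triple be -bb' addnK.
have [a0 _ /eqP<- _ _] := and5P rt.
by rewrite addKn mulKn.
Qed.

Lemma reduced_triple_dvd4 m a b c :
  reduced_triple m (a, b, c) -> ~~ odd a -> [/\ odd c, ~~ odd b & 4 %| a].
Proof.
move=> /and5P[_ _ /eqP e _ /andP[_ oac]] oa; rewrite (negbTE oa) /= in oac.
have ob : ~~ odd b.
  have := congr1 odd e.
  by rewrite !(oddD, oddM, oddX)/= (negbTE oa) oac; case: (odd b).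
split=> //; rewrite -(@Gauss_dvdl _ _ c); last first.
  by rewrite (@coprime_pexpl 2 2)// coprime2n.
rewrite -(@dvdn_addr (b ^ 2)); first by rewrite e dvdn_mulr.
by apply: (@dvdn_exp2r 2 b 2); rewrite dvdn2.
Qed.

(** An odd a is kept. Otherwise 4 divides a and b is even, so c' = c + 2 b n - a n^2 is congruent to
    c modulo 4. *)
Lemma plus_genus_reflect m s t : s ^ 2 < 4 * m < s.+1 ^ 2 ->
  reduced_triple m t -> plus_genus (reflect_triple m s t) = plus_genus t.
Proof.
move: t => [[a b] c] sP rt.
have [b' [c' [-> _ _ _]]] := reflect_tripleP sP rt.
rewrite /plus_genus; have [//|oa] := boolP (odd a).
have [_ ob a4] := reduced_triple_dvd4 rt oa.
move: ob a4; rewrite -dvdn2 => /dvdnP[b1 ->] /dvdnP[a1 ->].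
set n := _ %/ _; lia.
Qed.

(** * Fixed points of the reflection *)

(** At a fixed point 2b = a n. An odd a divides b, hence p. An even a is 4 a1 with b = 2 a1 n, and
    the equation becomes a1 (a1 n^2 + c) = p, so a1 is 1 or p. *)
Lemma plus_fixedP p s a b c : prime p -> 2 < p -> s ^ 2 < 4 * p < s.+1 ^ 2 ->
  reduced_triple p (a, b, c) -> plus_genus (a, b, c) ->
  reflect_triple p s (a, b, c) = (a, b, c) ->
  (a, b) = (1, s) \/ [/\ p %% 4 = 3, p <> 3 & (a, b) = (4, s %/ 4 * 4)].
Proof.
move=> p_pr p_gt2 sP rt pt fixt.
have [b' [c' [t' _ bb' _ _]]] := reflect_tripleP sP rt.
have eb : b' = b by move: t'; rewrite fixt => -[].
move: bb'; rewrite eb {b' c' eb t' fixt}.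
move: (_ %/ _) => n bn; have /andP[s1 s2] := sP.
have b0 : 0 < b.
  by have [_ _ _ h1 /andP[h2 _]] := and5P rt; lia.
move: (rt); rewrite (reduced_tripleE _ _ _ sP).
move=> /and5P[a0 /eqP e bs sab /andP[abs oac]].
move: pt; rewrite /plus_genus; have [oa a1|oa c3] := boolP (odd a).
  have ab : a %| b.
    rewrite -(@Gauss_dvdr _ 2) ?coprimen2//.
    by apply/dvdnP; exists n; lia.
  have ap : a %| p.
    rewrite -(@Gauss_dvdr _ 4); last first.
      by rewrite coprime_sym (@coprime_pexpl 2 2)// coprime2n.
    by rewrite -e dvdn_add ?dvdn_mulr// dvdn_exp.
  have [a_1|ap1] : a = 1 \/ a = p.
    by have /primeP[_ /(_ _ ap)/orP[/eqP|/eqP]] := p_pr; tauto.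
    by left; congr (_, _) => //; lia.
  (* If a = p, then p^2 <= s^2 < 4p forces a = p = 3, which is not 1 modulo 4. *)
  have pb : p <= b by rewrite -ap1 dvdn_leq.
  have p3 : p < 4.
    rewrite -(ltn_pmul2r (_ : 0 < p)); last lia.
    rewrite mulnn; apply: leq_ltn_trans s1; rewrite leq_exp2r//.
    exact: leq_trans bs.
  by lia.
have [oc _ /dvdnP[a1 a1E]] := reduced_triple_dvd4 rt oa.
have bE : b = 2 * (a1 * n) by lia.
have e1 : a1 * (a1 * n ^ 2 + c) = p.
  by apply/eqP; rewrite -(eqn_pmul2l (_ : 0 < 4))// -e bE a1E; apply/eqP; lia.
have n0 : 0 < n by lia.
have a4 : a = 4.
  have /primeP[_ /(_ a1)] := p_pr; rewrite -{1}e1 dvdn_mulr// => /(_ isT).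
  case/orP => /eqP h; first by lia.
  have : p * n ^ 2 + c = 1.
    by apply/eqP; rewrite -(eqn_pmul2l (_ : 0 < p)) ?muln1 -?{1}h ?e1//; lia.
  have : p <= p * n ^ 2 by rewrite leq_pmulr// expn_gt0 n0.
  by lia.
have a11 : a1 = 1 by lia.
rewrite a11 in e1 bE.
have op : odd p by apply: contraTT p_pr => h; apply/negP => /even_prime; lia.
(* Now n^2 + c = p with c and p odd. As n is even, p = c = 3 modulo 4, and n > 0 rules out p = 3. *)
have /dvdnP[k kE] : 2 %| n.
  rewrite dvdn2; have := congr1 odd e1.
  by rewrite !(oddD, oddM, oddX)/= oc op; case: (odd n).
right; split; [rewrite -e1 kE; lia| |].
  have : 0 < k ^ 2 by rewrite expn_gt0; lia.
  by move: e1; rewrite kE; lia.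
(* Here b is a multiple of 4 with b <= s < b + 4. *)
by rewrite a4; congr (_, _); lia.
Qed.

(** The exponent of p is even on the left and odd on the right. The factor d^2 serves as the squared
    denominator of a rational number. *)
Lemma four_prime_nonsquare p n d :
  prime p -> 2 < p -> 0 < d -> n ^ 2 <> 4 * p * d ^ 2.
Proof.
move=> p_pr p_gt2 d0 /(congr1 (odd \o logn p)) /=.
have p4 : logn p 4 = 0.
  by rewrite (lognX p 2 2) (logn_prime _ (_ : prime 2)) //; case: eqP => //; lia.
have p0 := prime_gt0 p_pr.
rewrite lognX lognM ?muln_gt0 ?expn_gt0 ?p0 ?d0// lognM// p4 lognX.
by rewrite (@logn_prime p p)// eqxx add0n oddD !oddM.
Qed.

Lemma odd_card_plus_genus p : prime p -> 2 < p ->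
  odd #|` [fset t in reduced_triples p | plus_genus t]| =
  ~~ ((p %% 4 == 3) && (p != 3)).
Proof.
move=> p_pr p_gt2.
have [s sP] := sqrt_bounds (4 * p).
have {}sP : s ^ 2 < 4 * p < s.+1 ^ 2.
  move: sP => /andP[]; rewrite leq_eqVlt => /orP[/eqP e _|-> -> //].
  by have := @four_prime_nonsquare p s 1 p_pr p_gt2; rewrite e; lia.
have := in_reduced_triples p; move: (reduced_triples p) => A inA.
set P := [fset t in A | plus_genus t].
have inP t : (t \in P) = reduced_triple p t && plus_genus t.
  by rewrite !inE /= inA.
have /andP[s1 s2] := sP.
rewrite (@odd_card_involution _ (reflect_triple p s)); last 2 first.
- move=> t; rewrite !inP => /andP[rt pt].
  by rewrite reflect_triple_reduced// (plus_genus_reflect sP).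
- by move=> t; rewrite !inP => /andP[rt pt]; exact: reflect_tripleK.
set F := [fset t in P | _].
have inF t : (t \in F) =
    [&& reduced_triple p t, plus_genus t & reflect_triple p s t == t].
  by rewrite in_fset /= -topredE /= inP andbA.
(* The two candidates for fixed points; their last entries are forced by b^2 + a c = 4p. *)
pose t1 := (1, s, 4 * p - s ^ 2); pose t2 := (4, s %/ 4 * 4, p - 4 * (s %/ 4) ^ 2).
have Ft1 : t1 \in F.
  rewrite inF /t1 (reduced_tripleE _ _ _ sP) /=.
  rewrite mul1n subnKC ?eqxx ?leqnn ?ltnSn ?divn1 ?mul1n ?addnK ?(ltnW s1)//=.
  by rewrite eqxx andbT; lia.
have Fsub t : t \in F -> t = t1 \/ [/\ p %% 4 = 3, p <> 3 & t = t2].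
  rewrite inF; case: t => [[a b] c] /and3P[rt pt /eqP ft].
  have [_ _ /eqP e _ _] := and5P rt.
  have [[aE bE]|[p43 p3 [aE bE]]] := plus_fixedP p_pr p_gt2 sP rt pt ft.
    by left; rewrite /t1 aE bE; congr (_, _); rewrite -e aE bE addKn mul1n.
  right; split=> //; rewrite /t2 aE bE; congr (_, _).
  by move: e; rewrite aE bE; lia.
have [/andP[/eqP p43 p3]|np] := boolP ((p %% 4 == 3) && (p != 3)).
  have p7 : 7 <= p by lia.
  have s4 : 4 <= s by nia.
  have Ft2 : t2 \in F.
    rewrite inF /t2 (reduced_tripleE _ _ _ sP) /=.
    have k0 : 0 < s %/ 4 by rewrite divn_gt0.
    have ks : s %/ 4 * 4 <= s by exact: leq_divM.
    have sk : s < s %/ 4 * 4 + 4 by lia.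
    move: (s %/ 4) k0 ks sk => k k0 ks sk.
    have kp : 4 * k ^ 2 <= p.
      rewrite -(leq_pmul2l (_ : 0 < 4))//; apply: leq_trans (ltnW s1).
      by rewrite mulnA -[4 * 4]/(4 ^ 2) -expnMn leq_exp2r// mulnC.
    have e : (k * 4) ^ 2 + 4 * (p - 4 * k ^ 2) = 4 * p.
      by rewrite mulnBr expnMn; lia.
    rewrite e eqxx ks /=.
    have -> : (k * 4 + s) %/ 4 = k * 2 by lia.
    have -> : 4 * (k * 2) - k * 4 = k * 4 by lia.
    rewrite -e addKn mulKn// eqxx andbT.
    (* The last entry p - 4k^2 is 3 modulo 4 because p is; this gives both its parity and the
       genus. *)
    by move: (k ^ 2) kp e => x kp e; lia.
  rewrite (_ : F = [fset t1; t2]) ?cardfs2//.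
  apply/fsetP => t; rewrite in_fset2; apply/idP/idP.
    by move=> /Fsub[->|[_ _ ->]]; rewrite eqxx ?orbT.
  by move=> /orP[]/eqP->.
rewrite (_ : F = [fset t1]) ?cardfs1//.
apply/fsetP => t; rewrite in_fset1; apply/idP/eqP => [|-> //].
by move=> /Fsub[->//|[p43 /eqP p3 _]]; rewrite p43 p3 in np.
Qed.

(** * From triples to reduced quadratic numbers *)

(** This makes a X^2 - 2b X - c primitive, so that its root has discriminant 16p. A common prime
    factor q is odd, as a and c are not both even; so q divides b, and q^2 divides b^2 + a c = 4p,
    hence p. *)
Lemma reduced_triple_gcd p a b c : prime p -> 2 < p ->
  reduced_triple p (a, b, c) -> gcdn (gcdn a (2 * b)) c = 1.
Proof.
move=> p_pr p_gt2 /and5P[a0 _ /eqP e _ /andP[_ oac]]; apply/eqP/contraT => g1.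
have g0 : 0 < gcdn (gcdn a (2 * b)) c by rewrite !gcdn_gt0 a0.
have q_pr : prime (pdiv (gcdn (gcdn a (2 * b)) c)).
  by rewrite pdiv_prime// ltn_neqAle eq_sym g1.
have := pdiv_dvd (gcdn (gcdn a (2 * b)) c).
move: (pdiv _) q_pr => q q_pr; rewrite !dvdn_gcd => /andP[/andP[qa q2b] qc].
have q2 : q != 2 by apply: contraTneq oac => q2; move: qa qc; rewrite q2 !dvdn2; lia.
have cq2 : coprime q 2 by rewrite prime_coprime// dvdn_prime2.
have qb : q %| b by rewrite -(@Gauss_dvdr _ 2).
have : q ^ 2 %| 4 * p by rewrite -e dvdn_addr ?dvdn_exp2r// dvdn_mul.
rewrite Gauss_dvdr; last by rewrite coprimeXl// (@coprimeXr 2 q 2).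
move=> qqp; have := dvdn_trans (dvdn_exp _ (dvdnn q)) qqp => /(_ isT).
rewrite dvdn_prime2// => /eqP qp; move: qqp; rewrite qp.
move=> /(dvdn_leq (prime_gt0 p_pr)); rewrite leqNgt -{1}(expn1 p) ltn_exp2l//.
exact: prime_gt1.
Qed.

Local Open Scope ring_scope.

Lemma rat_sqr_neq_four_prime p (q : rat) : prime p -> (2 < p)%N ->
  q ^+ 2 != (4 * p)%N%:R.
Proof.
move=> p_pr p_gt2; apply/eqP => q2.
have d0 : (0 < `|denq q|)%N by rewrite absz_gt0 denq_neq0.
apply: (@four_prime_nonsquare p `|numq q| `|denq q| p_pr p_gt2 d0).
have : numq q ^+ 2 = (4 * p)%N%:Z * denq q ^+ 2.
  apply: (@intr_inj rat); rewrite rmorphXn rmorphM rmorphXn /= -[X in _ = X * _]q2.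
  by rewrite -exprMn; congr (_ ^+ 2); rewrite -{2}(divq_num_den q) divfK//
    intr_eq0 denq_neq0.
by move=> /(congr1 absz); rewrite abszM !abszX.
Qed.

Section ReducedNumbers.
Variable R : realType.

Lemma irrational_sqrt_four_prime p : prime p -> (2 < p)%N ->
  irrational (Num.sqrt (4 * p)%N%:R : R).
Proof.
move=> p_pr p_gt2 [q _ qE]; have /eqP := rat_sqr_neq_four_prime q p_pr p_gt2.
apply; apply: (fmorph_inj (@ratr R)).
by rewrite rmorphXn /= qE sqr_sqrtr ?ler0n// ratr_nat.
Qed.

(** The remainder of q modulo the quadratic is r0 + r1 X with r0, r1 rational; it vanishes at an
    irrational z only if it is zero. The criterion does not mention z, so irrational roots of the
    same quadratic are roots of the same rational polynomials. *)
Lemma root_ratr_irrational (S P : rat) (q : {poly rat}) (z : R) :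
  irrational z -> z ^+ 2 - ratr S * z + ratr P = 0 ->
  root (map_poly ratr q) z = (('X^2 + (- S *: 'X + P%:P)) %| q)%R.
Proof.
move=> zirr zM; set M := 'X^2 + _.
have szM : size M = 3%N.
  rewrite /M size_polyDl size_polyXn// ltnS (leq_trans (size_polyD _ _))//.
  rewrite geq_max (leq_trans (size_scale_leq _ _)) ?size_polyX//=.
  by rewrite (leq_trans (size_polyC_leq1 _)).
have Mz : (map_poly ratr M).[z] = 0.
  rewrite /M !rmorphD /= map_polyZ /= map_polyXn map_polyX map_polyC /=.
  by rewrite !hornerE /= rmorphN mulNr.
rewrite {1}(divp_eq q M) rmorphD rmorphM /= rootE hornerD hornerM Mz mulr0 add0r.
rewrite /dvdp; have : (size (q %% M)%R <= 2)%N.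
  by rewrite -ltnS -szM ltn_modpN0// -size_poly_gt0 szM.
move: (_ %% _) => r sr.
have -> : (map_poly ratr r).[z] = ratr r`_0 + ratr r`_1 * z.
  rewrite (@horner_coef_wide _ 2) ?(leq_trans (size_poly _ _))//.
  by rewrite !big_ord_recl big_ord0 !coef_map /= expr0 mulr1 expr1 addr0.
apply/eqP/eqP => [rz|->]; last by rewrite !coef0 !rmorph0 mul0r addr0.
have r1 : r`_1 = 0.
  apply/eqP/contraT => r1; exfalso; apply: zirr.
  exists (- r`_0 / r`_1) => //; rewrite rmorphM rmorphN fmorphV.
  apply: (canLR (mulfK _)); rewrite ?fmorph_eq0//; lra.
have r0 : r`_0 = 0.
  move: rz; rewrite r1 rmorph0 mul0r addr0 => /eqP.
  by rewrite fmorph_eq0 => /eqP.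
apply/polyP => -[|[|i]]; rewrite coef0 ?r0 ?r1//.
by rewrite nth_default// (leq_trans sr).
Qed.

Lemma irrational_conjugate (S P : rat) (w v : R) : irrational w ->
  w + v = ratr S -> w * v = ratr P -> v <> w -> conjugate w v.
Proof.
move=> wirr SE PE vw; split=> // q.
have virr : irrational v.
  move=> [x _ xv]; apply: wirr; exists (S - x) => //.
  by rewrite rmorphB /= xv -SE addrK.
by rewrite (@root_ratr_irrational S P) ?(@root_ratr_irrational S P q v)//;
  rewrite -SE -PE; ring.
Qed.


Definition triple_root p (t : nat * nat * nat) : R :=
  let: (a, b, c) := t in (b%:R + Num.sqrt (4 * p)%N%:R) / a%:R.

Lemma reduced_triple_root p t : prime p -> (2 < p)%N -> reduced_triple p t ->
  reduced_of_disc (16 * p)%N (triple_root p t).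
Proof.
case: t => [[a b] c] p_pr p_gt2 rt.
have gcd1 := reduced_triple_gcd p_pr p_gt2 rt.
have [a0 c0 /eqP e ac /andP[ca _]] := and5P rt.
rewrite /triple_root; set s : R := Num.sqrt _.
have sirr : irrational s by exact: irrational_sqrt_four_prime.
have aR : 0 < a%:R :> R by rewrite ltr0n.
have s0 : 0 <= s by exact: sqrtr_ge0.
have s2 : s ^+ 2 = b%:R ^+ 2 + a%:R * c%:R.
  by rewrite sqr_sqrtr ?ler0n// -e natrD natrX natrM.
have b0 : 0 <= b%:R :> R by exact: ler0n.
have cR : 0 < c%:R :> R by rewrite ltr0n.
have acR : a%:R < c%:R + 2 * b%:R :> R by rewrite -natrM -natrD ltr_nat.
have caR : c%:R < a%:R + 2 * b%:R :> R by rewrite -natrM -natrD ltr_nat.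
set w := _ / _; pose v := (b%:R - s) / a%:R.
have aw : a%:R * w = b%:R + s by rewrite mulrC divfK ?gt_eqF.
have av : a%:R * v = b%:R - s by rewrite mulrC divfK ?gt_eqF.
have bs : b%:R < s by nra.
have wirr : irrational w.
  move=> [q _ qw]; apply: sirr; exists (a%:R * q - b%:R) => //.
  by rewrite rmorphB rmorphM /= !ratr_nat qw aw addrC addKr.
have wroot : quadratic_root a%:Z (- (2 * b)%N%:Z) (- c%:Z) w.
  rewrite /quadratic_root; apply: (mulfI (lt0r_neq0 aR)).
  rewrite !rmorphN /= -!pmulrn natrM mulr0.
  transitivity ((a%:R * w) ^+ 2 - 2 * b%:R * (a%:R * w) - a%:R * c%:R).
    by ring.
  by rewrite aw; move: s2; lra.
have aZ : (0 < a%:Z :> int) by rewrite ltz_nat.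
split; last first.
  exists a%:Z, (- (2 * b)%N%:Z), (- c%:Z); split=> //.
    by rewrite /gcdz !abszN !absz_nat gcd1.
  lia.
split.
- split=> //; exists a%:Z, (- (2 * b)%N%:Z), (- c%:Z); split=> //.
  by rewrite gt_eqF.
- by rewrite -(ltr_pM2l aR) aw mulr1; nra.
exists v.
  have an0 := lt0r_neq0 aR.
  apply: (@irrational_conjugate (2 * b%:R / a%:R) (- (c%:R / a%:R))) => //.
  - rewrite !rmorphM fmorphV /= !ratr_nat; apply: (mulfI an0).
    by rewrite mulrDr aw av mulrC divfK//; ring.
  - rewrite rmorphN rmorphM fmorphV /= !ratr_nat.
    apply: (mulfI an0); apply: (mulfI an0).
    transitivity ((a%:R * w) * (a%:R * v)); first by ring.
    rewrite aw av mulrC -subr_sqr s2; apply/eqP.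
    by rewrite mulrN mulrCA mulfV// mulr1; apply/eqP; ring.
  - by move=> vw; rewrite vw aw in av; clear -av bs b0; lra.
(* This is -1 < v. If s >= a + b, squaring gives a c >= a^2 + 2 a b, against c < a + 2b. *)
have sab : s < a%:R + b%:R.
  have : a%:R * c%:R < a%:R * (a%:R + 2 * b%:R) :> R by rewrite ltr_pM2l.
  move=> h; rewrite ltNge; apply/negP => hs; move: h.
  have : 0 <= (s - (a%:R + b%:R)) * (s + a%:R + b%:R).
    by apply: mulr_ge0; [rewrite subr_ge0|rewrite !addr_ge0// ltW].
  by move: s2; clear; lra.
by rewrite -(ltr_pM2l aR) -(ltr_pM2l aR v) av; apply/andP; split; lra.
Qed.

(** Let f = a X^2 + b X + c vanish at w and v. The positions of the roots give f(0) < 0, f(1) < 0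
    and f(-1) > 0, which are the inequalities of [reduced_triple] for (a, -b/2, -c). The
    discriminant makes b even, and primitivity then excludes that a and c are both even. *)
Lemma reduced_of_disc_triple p w : prime p -> (2 < p)%N ->
  reduced_of_disc (16 * p)%N w ->
  exists2 t, reduced_triple p t & w = triple_root p t.
Proof.
move=> p_pr p_gt2 [[[wirr _] w1 [v wv /andP[v1 v0]]]].
move=> [a [b [c [a0 gcd1 hw DE]]]].
have hv := quadratic_root_conjugate wv hw.
have vw : v - w != 0 by rewrite subr_eq0; apply/eqP; case: wv.
have aR : 0 < (a%:~R : R) by rewrite ltr0z.
have bE : (b%:~R : R) = - a%:~R * (v + w).
  move: hw hv; rewrite /quadratic_root => hw hv.
  apply: (mulIf vw); apply/eqP; rewrite -subr_eq0; apply/eqP; lra.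
have cE : (c%:~R : R) = a%:~R * (v * w).
  by move: hw; rewrite /quadratic_root bE => hw; lra.
have c0 : c < 0.
  by rewrite -(ltrz0 R) cE pmulr_rlt0// nmulr_rlt0//; lra.
have v1w : 0 < a%:~R * ((1 - v) * (w - 1)) by rewrite !mulr_gt0 ?subr_gt0//; lra.
have abc : a + b + c < 0.
  by rewrite -(ltrz0 R) !rmorphD /= bE cE; lra.
have v1w' : 0 < a%:~R * ((1 + v) * (w + 1)) by rewrite !mulr_gt0//; lra.
have abc' : 0 < a - b + c.
  by rewrite -(ltr0z R) rmorphD rmorphB /= bE cE; lra.
have [k [bk|bk]] : exists k : int, b = 2 * k + 1 \/ b = 2 * k.
- by exists (b %/ 2)%Z; lia.
- by exfalso; move: DE; rewrite bk; lia.
have k0 : k < 0 by lia.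
exists (`|a|%N, `|k|%N, `|c|%N).
  apply/and5P; split; [lia|lia| |lia|apply/andP; split; first lia].
    by apply/eqP; move: DE; rewrite bk; nia.
  apply/negPn/negP => oac.
  have : (2 %| gcdz (gcdz a b) c)%Z.
    by rewrite !dvdz_gcd bk dvdz_mulr// andbT; lia.
  by rewrite gcd1.
have aE : (`|a|%N%:R : R) = a%:~R by rewrite natr_absz gtr0_norm.
have kE : (`|k|%N%:R : R) = - k%:~R by rewrite natr_absz ltr0_norm// rmorphN.
have {}bE : 2 * k%:~R = - a%:~R * (v + w) by rewrite -bE bk rmorphM.
have DR : (4 * p)%N%:R = (a%:~R * w + k%:~R) ^+ 2.
  have : (4 : R) * (4 * p)%N%:R = 4 * (a%:~R * w + k%:~R) ^+ 2; last by lra.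
  rewrite -natrM (_ : (4 * (4 * p))%N = (16 * p)%N); last by lia.
  rewrite -[_%:R]/((16 * p)%N%:Z%:~R) DE bk.
  rewrite !(rmorphB, rmorphM, rmorphXn)/= cE.
  have -> : k%:~R = - a%:~R * (v + w) / 2 :> R by move: bE; clear; lra.
  by field.
(* The root has the right sign since a w + k = a (w - v) / 2 > 0. *)
rewrite /triple_root aE kE DR sqrtr_sqr ger0_norm; last by nra.
by rewrite addrC addrK mulrC mulKf// lt0r_neq0.
Qed.

(** As s is irrational, comparing its coefficients in a' (b + s) = a (b' + s) gives a = a'; then b =
    b', and the equation determines c. *)
Lemma triple_root_inj p : prime p -> (2 < p)%N ->
  {in reduced_triple p &, injective (triple_root p)}.
Proof.
move=> p_pr p_gt2 [[a b] c] [[a' b'] c'] rt rt'.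
have [a0 _ /eqP e _ _] := and5P rt.
have [a0' _ /eqP e' _ _] := and5P rt'.
rewrite /triple_root; set s : R := Num.sqrt _ => h.
have sirr : irrational s by exact: irrational_sqrt_four_prime.
have aR : 0 < a%:R :> R by rewrite ltr0n.
have aR' : 0 < a'%:R :> R by rewrite ltr0n.
have {}h : a'%:R * (b%:R + s) = a%:R * (b'%:R + s).
  move/eqP: h; rewrite eqr_div ?lt0r_neq0// => /eqP h.
  by rewrite mulrC h mulrC.
have aa' : a = a'.
  apply/eqP; rewrite -(eqr_nat R); apply/contraT => aa'.
  exfalso; apply: sirr.
  exists ((a'%:R * b%:R - a%:R * b'%:R) / (a%:R - a'%:R)) => //.
  rewrite rmorphM fmorphV !rmorphB !rmorphM /= !ratr_nat.
  apply: (canLR (mulfK _)); rewrite ?subr_eq0//.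
  by move: h; lra.
have bb' : b = b'.
  apply/eqP; rewrite -(eqr_nat R); move: h; rewrite aa'.
  by move=> /(mulfI (lt0r_neq0 aR')) /addIr ->.
rewrite aa' bb' in e *; congr (_, _); apply/eqP.
by rewrite -(eqn_pmul2l a0') -(eqn_add2l (b' ^ 2)) e e'.
Qed.

Lemma kappa_card p : prime p -> (2 < p)%N ->
  kappa R (16 * p)%N = #|` reduced_triples p|.
Proof.
move=> p_pr p_gt2; rewrite /kappa.
have -> : fset_set (reduced_of_disc (R := R) (16 * p)) =
    [fset triple_root p t | t in reduced_triples p].
  apply/fsetP => w; rewrite in_fset_set; last exact: finite_reduced_of_disc.
  apply/idP/imfsetP => /=.
    rewrite inE => /reduced_of_disc_triple[]// t rt ->.
    by exists t; rewrite ?in_reduced_triples.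
  move=> [t]; rewrite in_reduced_triples => rt ->; rewrite inE.
  exact: reduced_triple_root.
apply: card_in_imfset => t t' /=; rewrite !in_reduced_triples.
exact: triple_root_inj.
Qed.

End ReducedNumbers.

Local Close Scope ring_scope.

Theorem theorem3p10 (R : realType) (p : nat) (p_prime : prime p)
    (p_gt2 : 2 < p) :
  ((p = 3 \/ p = 1 %[mod 4]) -> kappa R (16 * p) = 2 %[mod 4]) /\
  (p = 3 %[mod 4] /\ p <> 3 -> kappa R (16 * p) = 0 %[mod 4]).
Proof.
rewrite kappa_card// card_reduced_triples.
have := odd_card_plus_genus p_prime p_gt2; move: #|` _| => K oddK.
by split=> h; lia.
Qed.
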